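(* Let $\mathbb{P}^{s-1}$ be a projective space over a finite field $K=\mathbb{F}_q$, let $S=K[t_1,\ldots,t_s]$ with the standard grading, let $\mathbb{X}=V_{\mathbb{P}^{s-1}}(G)$ be the projective variety defined by a finite set $G$ of homogeneous polynomials of $S\setminus\{0\}$, and let $I(\mathbb{X})$ be its homogeneous vanishing ideal. If $(I(\mathbb{P}^{s-1})\colon(G))\neq I(\mathbb{P}^{s-1})$, then $$ {\rm rad}(I(\mathbb{P}^{s-1}),G)={\rm rad}(\{t_it_j^q-t_i^qt_j\mid 1\leq i<j\leq s\},G)=I(\mathbb{X}). $$
   Context: $\mathbb{P}^{s-1}$ denotes the (finite) set of $K$-rational points of projective $(s-1)$-space, i.e. $K^s\setminus\{0\}$ modulo scaling by $K^*$. $V_{\mathbb{P}^{s-1}}(G)$ is the set of points of $\mathbb{P}^{s-1}$ at which all elements of $G$ vanish. For a set of points $\mathbb{Y}\subset\mathbb{P}^{s-1}$, $I(\mathbb{Y})$ is the ideal of $S$ generated by the homogeneous polynomials vanishing at all points of $\mathbb{Y}$. $(G)$ is the ideal generated by $G$; $(J\colon(G))=\{g\in S\mid g(G)\subset J\}$ is the colon ideal; $(J,G)$ is the ideal generated by $J\cup G$, and ${\rm rad}(J,G)$ is its radical. *)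

(* Defs.v *)
From HB Require Import structures.
From mathcomp Require Import all_boot all_order all_algebra generic_quotient.
From mathcomp Require Import finmap mpoly.
From mathcomp Require Import boolp classical_sets.

Set Implicit Arguments.
Unset Strict Implicit.
Unset Printing Implicit Defensive.

Import GRing.Theory.

Local Open Scope ring_scope.
Local Open Scope classical_set_scope.
Local Open Scope quotient_scope.

Section Ideals.
Variable R : comNzRingType.
Implicit Types (I A B : set R).

(* [idealr_closed] is not used: it only covers boolean predicates and proper
   ideals, whereas a vanishing ideal or a colon ideal may be the whole ring. *)
Definition is_ideal I : Prop :=
  [/\ I 0, forall x y, I x -> I y -> I (x + y)
    & forall a x, I x -> I (a * x)].

Definition ideal_gen A : set R := smallest is_ideal A.

Definition colon I B : set R := [set g | forall b, B b -> I (g * b)].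

Definition radical I : set R := [set f | exists2 n, (0 < n)%N & I (f ^+ n)].

End Ideals.

Section ProjectiveSpace.
Variables (K : finFieldType) (s : nat).

Definition nonzero_vec := {v : 'rV[K]_s | v != 0}.

Definition proportional : rel nonzero_vec :=
  fun u v => [exists c : K, (c != 0) && (val u == c *: val v)].

Lemma proportional_refl : reflexive proportional.
Proof.
by move=> u; apply/existsP; exists 1; rewrite oner_neq0 scale1r eqxx.
Qed.

Lemma proportional_sym : ssrbool.symmetric proportional.
Proof.
have sub u v : proportional u v -> proportional v u.
  move=> /existsP[c /andP[c0 /eqP uv]]; apply/existsP; exists c^-1.
  by rewrite invr_eq0 c0 uv scalerA mulVf // scale1r eqxx.
by move=> u v; apply/idP/idP; apply: sub.
Qed.

Lemma proportional_trans : transitive proportional.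
Proof.
move=> v u w /existsP[c /andP[c0 /eqP uv]] /existsP[d /andP[d0 /eqP vw]].
by apply/existsP; exists (c * d); rewrite mulf_neq0 // uv vw scalerA eqxx.
Qed.

Canonical proportional_equiv :=
  EquivRel proportional proportional_refl proportional_sym proportional_trans.

(* P^(s-1)(K): homogeneous coordinates are indexed by 'I_s. *)
Definition proj_space := {eq_quot proportional}.

(* All representatives are required to be zeros of [f], so that the predicate
   makes sense for an arbitrary [f]; for homogeneous [f] one suffices. *)
Definition vanishes_at (f : {mpoly K[s]}) (P : proj_space) : Prop :=
  forall v : nonzero_vec, \pi_proj_space v = P -> f.@[fun i => val v 0 i] = 0.

Definition proj_zeros (G : set {mpoly K[s]}) : set proj_space :=
  [set P | forall f, G f -> vanishes_at f P].

Definition vanishing_ideal (Y : set proj_space) : set {mpoly K[s]} :=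
  ideal_gen
    [set f | f \is homog mdeg /\ forall P, Y P -> vanishes_at f P].

Definition frobenius_binomials (q : nat) : set {mpoly K[s]} :=
  [set f | exists i j : 'I_s,
     (i < j)%N /\ f = 'X_i * 'X_j ^+ q - 'X_i ^+ q * 'X_j].

End ProjectiveSpace.

Arguments frobenius_binomials : clear implicits.

(* Main.v *)
(** A polynomial [f] lies in [I(Y)] iff, for every representative [v] of a point
    of [Y], its restriction [f(v T)] is zero in [K[T]]. So [I(Y)] is an
    intersection of kernels of ring morphisms to a domain; it is radical, and
    the colon condition forces the zero locus [X] of [G] to be nonempty.

    The inclusion of [I(X)] in [rad J], where [J] is generated by the binomials
    and [G], needs no Nullstellensatz. The homogenisation
      [t_i t_j^q - t_i^q t_j = t_i * \prod_c (t_j - c t_i)]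
    of [X^q - X = \prod_c (X - c)] shows that [t_i f] is in [rad J] as soon as
    it is in the radical of every ideal [I] containing [J] and some
    [t_j - v_j t_i] for all [j]. Modulo such an [I], a homogeneous [g] of degree
    [e] is [g(v) t_i^e], so [t_i] is in [rad I], or [v] represents a point
    of [X] and [f] is in [I]. Finally [f] itself is in [rad J] because a
    homogeneous [f] of positive degree lies in the ideal of the [t_i]; in degree
    0, [f] is a constant vanishing at a point of [X]. *)

Require Import Defs.
From mathcomp Require Import all_boot all_order all_algebra generic_quotient.
From mathcomp Require Import finfield finmap mpoly.
From mathcomp Require Import boolp classical_sets.

Set Implicit Arguments.
Unset Strict Implicit.
Unset Printing Implicit Defensive.

Import GRing.Theory.

Local Open Scope ring_scope.
Local Open Scope classical_set_scope.

(** * Ideals and radicals in a commutative ring *)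

Section IdealTheory.
Variable R : comNzRingType.
Implicit Types (I J A B : set R) (a x y : R).

Lemma ideal_gen_ideal A : is_ideal (ideal_gen A).
Proof.
split=> [J [[]]//|x y Ax Ay J CJ|a x Ax J CJ]; have [[_ JD JM] _] := CJ.
  exact: JD (Ax J CJ) (Ay J CJ).
exact: JM (Ax J CJ).
Qed.

Lemma ideal_gen_sub A J : is_ideal J -> A `<=` J -> ideal_gen A `<=` J.
Proof. exact: smallest_sub. Qed.

Lemma sub_ideal_gen A : A `<=` ideal_gen A.
Proof. exact: sub_gen_smallest. Qed.

Lemma idealMr I a x : is_ideal I -> I x -> I (x * a).
Proof. by case=> _ _ IM Ix; rewrite mulrC; apply: IM. Qed.

Lemma idealN I x : is_ideal I -> I x -> I (- x).
Proof. by case=> _ _ IM Ix; rewrite -mulN1r; apply: IM. Qed.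

Lemma idealB I x y : is_ideal I -> I x -> I y -> I (x - y).
Proof.
by move=> idI Ix Iy; have [_ ID _] := idI; apply: ID => //; apply: idealN.
Qed.

Lemma idealX I x m n : is_ideal I -> (m <= n)%N -> I (x ^+ m) -> I (x ^+ n).
Proof.
by move=> idI /subnK <-; rewrite exprD => Ix; have [_ _ IM] := idI; apply: IM.
Qed.

Lemma ideal_sum I (T : eqType) (r : seq T) (F : T -> R) :
  is_ideal I -> (forall i, i \in r -> I (F i)) -> I (\sum_(i <- r) F i).
Proof.
case=> I0 ID _ IF; rewrite big_seq.
by apply: big_ind => //; apply: ID.
Qed.

Lemma ideal_subM I a b x y :
  is_ideal I -> I (a - b) -> I (x - y) -> I (a * x - b * y).
Proof.
move=> idI Iab Ixy; have [_ ID IM] := idI.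
have -> : a * x - b * y = x * (a - b) + b * (x - y).
  by rewrite !mulrBr addrA [x * a]mulrC [x * b]mulrC subrK.
by apply: ID; apply: IM.
Qed.

Lemma ideal_subX I a b n : is_ideal I -> I (a - b) -> I (a ^+ n - b ^+ n).
Proof.
move=> idI Iab; elim: n => [|n IHn]; last by rewrite !exprS; apply: ideal_subM.
by rewrite subrr; case: idI.
Qed.

Lemma sub_radical I : I `<=` radical I.
Proof. by move=> x Ix; exists 1%N. Qed.

Lemma radicalS I J : I `<=` J -> radical I `<=` radical J.
Proof. by move=> sIJ x [n n0 Ix]; exists n => //; apply: sIJ. Qed.

Lemma radical_ideal I : is_ideal I -> is_ideal (radical I).
Proof.
move=> idI; have [I0 ID IM] := idI; split.
- exact: sub_radical.
- move=> x y [m m0 Ix] [n n0 Iy]; exists (m + n)%N; first by rewrite addn_gt0 m0.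
  rewrite exprDn; elim/big_ind: _ => // i _; rewrite -mulr_natl; apply: (IM).
  have [le_ni|/ltnW lt_in] := leqP n i.
    by apply: (IM); apply: idealX Iy.
  by apply: idealMr => //; apply: idealX Ix => //; rewrite -addnBA // leq_addr.
- by move=> a x [n n0 Ix]; exists n => //; rewrite exprMn; apply: IM.
Qed.

Lemma radical_exp I x n : (0 < n)%N -> radical I (x ^+ n) -> radical I x.
Proof.
move=> n0 [m m0 Ix]; exists (n * m)%N; first by rewrite muln_gt0 n0.
by rewrite exprM.
Qed.

(** For an ideal [I] this is the ideal generated by [I] and [a], in a form that exposes the cofactor
    of [a]. *)
Definition ideal_adjoin I a : set R := [set y | exists x, I (y - x * a)].

Lemma ideal_adjoin_ideal I a : is_ideal I -> is_ideal (ideal_adjoin I a).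
Proof.
move=> idI; have [I0 ID IM] := idI; split.
- by exists 0; rewrite mul0r subrr.
- move=> x y [b Ix] [c Iy]; exists (b + c).
  by rewrite mulrDl opprD addrACA; apply: ID.
- by move=> c x [b Ix]; exists (c * b); rewrite -mulrA -mulrBr; apply: IM.
Qed.

Lemma sub_ideal_adjoin I a : I `<=` ideal_adjoin I a.
Proof. by move=> x Ix; exists 0; rewrite mul0r subr0. Qed.

Lemma mem_ideal_adjoin I a : is_ideal I -> ideal_adjoin I a a.
Proof. by case=> I0 _ _; exists 1; rewrite mul1r subrr. Qed.

(* Elementary substitute for "a prime ideal containing the product contains a
   factor". *)
Lemma radical_adjoin_prod I (T : eqType) (r : seq T) (a : T -> R) h :
    is_ideal I -> (forall c, c \in r -> radical (ideal_adjoin I (a c)) h) ->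
    I (h * \prod_(c <- r) a c) ->
  radical I h.
Proof.
move=> idI rad_h Ih; have [I0 ID IM] := idI.
(* Multiplying the congruences [h ^+ m = y * a c] modulo [I], one for each [c], makes a power of [h]
   a multiple of the whole product; one more factor [h] then lands in [I]. *)
have [n [x Ix]] : exists n x, I (h ^+ n - x * \prod_(c <- r) a c).
  elim: r rad_h {Ih} => [|c r IHr] rad_h.
    by exists 0%N, 1; rewrite big_nil mulr1 subrr.
  have [n [x Ix]] : exists n x, I (h ^+ n - x * \prod_(c <- r) a c).
    by apply: IHr => d rd; apply: rad_h; rewrite inE rd orbT.
  have [m _ [y Iy]] := rad_h c (mem_head _ _).
  exists (m + n)%N, (y * x); rewrite exprD big_cons mulrACA.
  exact: ideal_subM.
exists n.+1 => //; have := ID _ _ (IM h _ Ix) (IM x _ Ih).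
by rewrite mulrBr -exprS mulrCA subrK.
Qed.

End IdealTheory.

(** * Homogeneous polynomials along a line *)

Section HomogeneousEvaluation.
Variables (R : comNzRingType) (s : nat).
Implicit Types (f : {mpoly R[s]}).

(** The choice of [S] covers rescaling a representative ([R]), restricting to a line ([{poly R}])
    and reducing modulo linear forms ([{mpoly R[s]}]). *)
Lemma mmap_homog (S : comNzRingType) (phi : {rmorphism R -> S})
    (v : 'I_s -> R) (t : S) d f :
  f \is d.-homog for mdeg ->
  mmap phi (fun i => phi (v i) * t) f = phi f.@[v] * t ^+ d.
Proof.
move=> /dhomogP hf; rewrite mevalE rmorph_sum mulr_suml [LHS]/mmap.
apply: eq_big_seq => m /hf <-; rewrite rmorphM -mulrA; congr (_ * _).
rewrite rmorph_prod /mmap1 /= mdegE -prodrXr -big_split /=.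
by apply: eq_bigr => i _; rewrite rmorphXn exprMn.
Qed.

Lemma mmap_subX (I : set {mpoly R[s]}) (h : 'I_s -> {mpoly R[s]}) f :
  is_ideal I -> (forall i, I ('X_i - h i)) -> I (f - mmap (@mpolyC s R) h f).
Proof.
move=> idI Ih; have [I0 ID IM] := idI.
rewrite {1}[f]mpolyE /mmap -sumrB; apply: ideal_sum => // m _.
rewrite -mul_mpolyC -mulrBr; apply: (IM); rewrite mpolyXE_id /mmap1.
elim/big_ind2: _ => [|*|i _]; first by rewrite subrr.
  exact: ideal_subM.
exact: ideal_subX.
Qed.

Lemma homog_line_eq (I : set {mpoly R[s]}) (v : 'I_s -> R) i d f :
    is_ideal I -> (forall j, I ('X_j - (v j)%:MP * 'X_i)) ->
    f \is d.-homog for mdeg ->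
  I (f - (f.@[v])%:MP * 'X_i ^+ d).
Proof.
by move=> idI Iv hf; rewrite -mmap_homog //; apply: mmap_subX.
Qed.

End HomogeneousEvaluation.

(** * Vanishing ideals of sets of projective points *)

Section ProjectiveVanishing.
Variables (K : finFieldType) (s : nat).
Implicit Types (f g : {mpoly K[s]}) (v : nonzero_vec K s).
Implicit Types (Y : set (proj_space K s)) (G : set {mpoly K[s]}).

Definition coords v : 'I_s -> K := fun i => val v 0 i.

Definition proj_pt v : proj_space K s := (\pi_(proj_space K s) v)%qT.

Lemma proj_ptE u v : proj_pt u = proj_pt v ->
  exists2 c, c != 0 & coords u =1 (fun i => c * coords v i).
Proof.
move=> /eqquotP /existsP[c /andP[c0 /eqP uv]]; exists c => // i.
by rewrite /coords uv mxE.
Qed.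

Lemma vanishes_at_homog f v d :
  f \is d.-homog for mdeg -> vanishes_at f (proj_pt v) <-> f.@[coords v] = 0.
Proof.
move=> hf; split=> [|fv u /proj_ptE[c _ uv]]; first exact.
rewrite -/(coords u) (@meval_eq _ _ _ (fun i => idfun (coords v i) * c)).
  by rewrite [_.@[_]](mmap_homog idfun _ _ hf) /= fv mul0r.
by move=> i; rewrite uv mulrC.
Qed.

Lemma proj_zerosP G v : (forall g, G g -> g \is homog mdeg) ->
  proj_zeros G (proj_pt v) <-> forall g, G g -> g.@[coords v] = 0.
Proof.
move=> homG; split=> Gv g Gg; have /homogP[d hg] := homG g Gg.
  by apply/(vanishes_at_homog v hg)/Gv.
by apply/(vanishes_at_homog v hg)/Gv.
Qed.

Definition on_line v : {rmorphism {mpoly K[s]} -> {poly K}} :=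
  mmap polyC (fun i => (coords v i)%:P * 'X).

Lemma on_line_homog f v d :
  f \is d.-homog for mdeg -> on_line v f = (f.@[coords v])%:P * 'X^d.
Proof. exact: mmap_homog. Qed.

Lemma on_lineX v i : on_line v 'X_i = (coords v i)%:P * 'X.
Proof. by rewrite /on_line /= mmapX mmap1U. Qed.

(* Since [K] is finite, vanishing on the affine cone over [Y] would be too weak:
   the restriction to each line has to be zero as a polynomial. *)
Lemma vanishing_idealP Y f :
  vanishing_ideal Y f <-> forall v, Y (proj_pt v) -> on_line v f = 0.
Proof.
split=> [If v Yv|f0].
  apply: (ideal_gen_sub (J := [set g | on_line v g = 0])) If.
    rewrite /mkset; split=> [|g h g0 h0|g h h0]; first exact: rmorph0.
      by rewrite rmorphD g0 h0 addr0.
    by rewrite rmorphM h0 mulr0.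
  move=> g [/homogP[d hg] /(_ _ Yv)/(vanishes_at_homog v hg) gv].
  by rewrite /mkset (on_line_homog _ hg) gv mul0r.
have idY := ideal_gen_ideal
  [set g | g \is homog mdeg /\ forall P, Y P -> vanishes_at g P].
(* It suffices that each homogeneous component of [f] is a generator. *)
have {1}-> := pihomog_partitionE (mf := mdeg) (leqnn (mmeasure mdeg f)).
apply: ideal_sum => // d _; apply: sub_ideal_gen.
have hd := pihomogP mdeg d f.
split=> [|P]; first by apply/homogP; exists d.
elim/quotW: P => v Yv; apply/(vanishes_at_homog v hd).
(* The coefficient of ['X^d] in [on_line v f] is the value at [v] of the component of degree [d]. *)
have := congr1 (fun p : {poly K} => p`_d) (f0 v Yv).
rewrite {1}[f](pihomog_partitionE (mf := mdeg) (leqnn _)) rmorph_sum coef_sum.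
rewrite coef0 (bigD1 d) //= big1 ?addr0 => [|e ne_ed].
  by rewrite (on_line_homog _ hd) coefCM coefXn eqxx mulr1.
rewrite (on_line_homog _ (pihomogP mdeg e f)) coefCM coefXn.
by rewrite eq_sym (inj_eq val_inj) (negPf ne_ed) mulr0.
Qed.


Lemma vanishing_ideal_radical Y f :
  radical (vanishing_ideal Y) f -> vanishing_ideal Y f.
Proof.
case=> n n0 /vanishing_idealP fn; apply/vanishing_idealP => v /fn.
by rewrite rmorphXn => /eqP; rewrite expf_eq0 n0 => /eqP.
Qed.

Lemma vanishing_ideal_homog Y f : f \is homog mdeg ->
  (forall v, Y (proj_pt v) -> f.@[coords v] = 0) -> vanishing_ideal Y f.
Proof.
move=> /homogP[d hf] fY; apply/vanishing_idealP => v Yv.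
by rewrite (on_line_homog _ hf) fY // mul0r.
Qed.

(** If [G] has no zero, every [v] has some [g] in [G] with nonzero restriction to its line; as
    [{poly K}] is a domain, [h * g] vanishing there forces [h] to vanish there. *)
Lemma proj_zeros_neq0 G : (forall g, G g -> g \is homog mdeg) ->
    colon (vanishing_ideal [set: proj_space K s]) (ideal_gen G)
      <> vanishing_ideal [set: proj_space K s] ->
  exists v, proj_zeros G (proj_pt v).
Proof.
move=> homG; apply: contra_notP => noZ; apply/seteqP; split=> h /=.
  move=> hGh; apply/vanishing_idealP => v _.
  have [g Gg gv] : exists2 g, G g & g.@[coords v] != 0.
    apply: contra_notP noZ => noG; exists v; apply/proj_zerosP => // g Gg.
    by apply: contra_notP noG => /eqP gv; exists g.
  have /vanishing_idealP/(_ v I) := hGh g (sub_ideal_gen Gg).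
  have /homogP[d hg] := homG g Gg.
  rewrite rmorphM (on_line_homog _ hg) => /eqP.
  rewrite !mulf_eq0 polyC_eq0 (negPf gv) expf_eq0 polyX_eq0 andbF.
  by rewrite /= orbF => /eqP.
by move=> Ih b _; apply: idealMr Ih; apply: ideal_gen_ideal.
Qed.

(** Since [a ^+ #|K| = a] on [K], both terms restrict to the same monomial on each line. *)
Lemma frobenius_binomial_vanishing (i j : 'I_s) :
  vanishing_ideal [set: proj_space K s]
    ('X_i * 'X_j ^+ #|K| - 'X_i ^+ #|K| * 'X_j).
Proof.
apply/vanishing_idealP => v _; rewrite rmorphB !rmorphM !rmorphXn !on_lineX.
rewrite !exprMn -!rmorphXn !expf_card mulrACA [X in _ - X]mulrACA.
by rewrite [X in _ * X - _]mulrC subrr.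
Qed.

End ProjectiveVanishing.

(* Homogenisation of [finField_genPoly]. *)
Lemma prod_frobenius_field (K : finFieldType) (L : fieldType)
    (phi : {rmorphism K -> L}) (x y : L) :
  x * \prod_(c : K) (y - phi c * x) = x * y ^+ #|K| - x ^+ #|K| * y.
Proof.
have K0 : (0 < #|K|)%N by apply/card_gt0P; exists 0.
have [->|x0] := eqVneq x 0; first by rewrite expr0n gtn_eqF // !mul0r subrr.
(* Evaluate at [y / x]; multiplying by [x ^+ #|K|.+1] then clears the denominators. *)
have := congr1 (fun p => (map_poly phi p).[y / x]) (finField_genPoly K).
rewrite rmorphB rmorphXn /= map_polyX rmorph_prod horner_prod !hornerE.
under eq_bigr do rewrite rmorphB /= map_polyX map_polyC !hornerE.
move=> prodE.
have -> : \prod_c (y - phi c * x) = x ^+ #|K| * \prod_c (y / x - phi c).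
  rewrite -[x ^+ _]prodr_const -big_split /=; apply: eq_bigr => c _.
  by rewrite mulrBr [x * (y / x)]mulrC divfK // [x * phi c]mulrC.
rewrite -prodE expr_div_n !mulrBr; congr (_ - _).
  by congr (_ * _); rewrite mulrC divfK // expf_neq0.
by rewrite mulrCA; congr (_ * _); rewrite mulrC divfK.
Qed.

Lemma prod_frobenius (K : finFieldType) (R : idomainType)
    (phi : {rmorphism K -> R}) (x y : R) :
  x * \prod_(c : K) (y - phi c * x) = x * y ^+ #|K| - x ^+ #|K| * y.
Proof.
apply/eqP; rewrite -tofrac_eq; apply/eqP.
rewrite rmorphB !rmorphM !rmorphXn rmorph_prod /=.
rewrite -(prod_frobenius_field (@tofrac R \o phi)).
by congr (_ * _); apply: eq_bigr => c _; rewrite rmorphB rmorphM.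
Qed.

(** * Radicals of ideals containing the Frobenius binomials *)

Section FrobeniusIdeal.
Variables (K : finFieldType) (s : nat) (J : set {mpoly K[s]}).
Hypothesis idJ : is_ideal J.
Hypothesis frobJ :
  forall i j : 'I_s, J ('X_i * 'X_j ^+ #|K| - 'X_i ^+ #|K| * 'X_j).

Lemma radical_on_points (i : 'I_s) h :
    (forall v (I : set {mpoly K[s]}), is_ideal I -> J `<=` I ->
      (forall j, I ('X_j - (v j)%:MP * 'X_i)) -> radical I ('X_i * h)) ->
  radical J ('X_i * h).
Proof.
move=> rad_h.
(* The list [l] holds the indices [j] for which ['X_j] need not yet be a scalar multiple of ['X_i]
   modulo [I]; each induction step removes one by adjoining a linear factor of a binomial. *)
suff gen (l : seq 'I_s) (I : set {mpoly K[s]}) : is_ideal I -> J `<=` I ->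
    (forall j, j \notin l -> exists c : K, I ('X_j - c%:MP * 'X_i)) ->
    radical I ('X_i * h).
  by apply: (gen (enum 'I_s)) => // j; rewrite mem_enum.
elim: l I => [|j l IHl] I idI sJI Il.
  have /choice[v Iv] : forall j, exists c : K, I ('X_j - c%:MP * 'X_i).
    by move=> j; apply: Il.
  exact: rad_h Iv.
apply: (radical_adjoin_prod (r := index_enum K)
          (a := fun c => 'X_j - c%:MP * 'X_i)) => // [c _|].
  apply: IHl; first exact: ideal_adjoin_ideal.
    by move=> x /sJI; apply: sub_ideal_adjoin.
  move=> k nlk; have [->|ne_kj] := eqVneq k j.
    by exists c; apply: mem_ideal_adjoin.
  have [|b Ib] := Il k; first by rewrite inE negb_or ne_kj.
  by exists b; apply: sub_ideal_adjoin.
rewrite mulrAC (prod_frobenius (@mpolyC s K)); apply: idealMr => //.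
by apply: sJI; apply: frobJ.
Qed.

Lemma radical_mulX (G : set {mpoly K[s]}) f i :
    G `<=` J -> (forall g, G g -> g \is homog mdeg) -> f \is homog mdeg ->
    (forall v, proj_zeros G (proj_pt v) -> f.@[coords v] = 0) ->
  radical J ('X_i * f).
Proof.
move=> GJ homG /homogP[d hf] fZ; apply: radical_on_points => v I idI sJI Iv.
have [_ _ IM] := idI.
suff: radical I 'X_i \/ I f.
  by case=> [|If]; [apply: idealMr; apply: radical_ideal
                   | apply: sub_radical; apply: IM].
(* For [j = i] the congruence says that [(1 - v i) 'X_i] lies in [I], so ['X_i] does unless
   [v i = 1]; in that case [v] is nonzero and represents a point. *)
have [vi1|vi1] := eqVneq (v i) 1; last first.
  left; apply: sub_radical; have := IM ((1 - v i)^-1)%:MP _ (Iv i).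
  rewrite -{1}['X_i]mul1r -mulrBl -mpolyC1 -mpolyCB mulrA -mpolyCM.
  by rewrite mulVf ?mul1r // subr_eq0 eq_sym.
have v0 : \row_j v j != 0.
  by apply/eqP => /rowP/(_ i); rewrite !mxE vi1 => /eqP; rewrite oner_eq0.
pose u : nonzero_vec K s := exist (fun x : 'rV_s => x != 0) _ v0.
have uv : coords u =1 v by move=> j; rewrite /coords mxE.
have [Zu|nZu] := pselect (proj_zeros G (proj_pt u)).
  right; have := homog_line_eq idI Iv hf.
  by rewrite -(meval_eq _ uv) fZ // mul0r subr0.
left; have [g Gg gu] : exists2 g, G g & g.@[v] != 0.
  apply: contra_notP nZu => noG; apply/proj_zerosP => // g Gg.
  by apply: contra_notP noG => /eqP; rewrite (meval_eq _ uv) => gv; exists g.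
have /homogP[e hg] := homG g Gg.
have := idealB idI (sJI g (GJ g Gg)) (homog_line_eq idI Iv hg).
rewrite subKr => /(IM (g.@[v]^-1)%:MP).
rewrite mulrA -mpolyCM mulVf // mul1r => IX.
(* The exponent is raised by one because [e] may be 0, while [radical] asks for a positive
   exponent. *)
by exists e.+1 => //; apply: idealX IX.
Qed.

End FrobeniusIdeal.

Lemma radical_of_mulX (K : fieldType) (s : nat) (J : set {mpoly K[s]}) f d :
    is_ideal J -> f \is d.+1.-homog for mdeg ->
    (forall i, radical J ('X_i * f)) ->
  radical J f.
Proof.
move=> idJ /dhomogP hf Jf; have idR := radical_ideal idJ; have [_ _ RM] := idR.
(* Every monomial of [f] is divisible by some ['X_i], so expanding one factor of [f * f] gives
   multiples of the ['X_i * f]. *)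
apply: (@radical_exp _ _ _ 2) => //; rewrite expr2 {1}[f]mpolyE mulr_suml.
apply: ideal_sum => // m /hf dm.
have [i mi] : exists i, (0 < m i)%N.
  apply/existsP; apply: contra_eqT dm; rewrite negb_exists => /forallP m0.
  rewrite /= mdegE big1 // => i _; apply/eqP.
  by rewrite -leqn0 leqNgt m0.
have le_im : (U_(i) <= m)%MM.
  by apply/mnm_lepP => j; rewrite mnm1E; case: eqP => // <-.
rewrite -(submK le_im) mpolyXD -mul_mpolyC -!mulrA.
by apply: (RM); apply: (RM).
Qed.

Lemma homog0_const (R : comNzRingType) (s : nat) (f : {mpoly R[s]}) v :
  f \is 0.-homog for mdeg -> f = (f.@[v])%:MP.
Proof.
move=> /dhomogP hf; rewrite mevalE {1}[f]mpolyE rmorph_sum.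
apply: eq_big_seq => m /hf/eqP; rewrite mdeg_eq0 => /eqP ->.
by rewrite mpolyX0 alg_mpolyC big1 ?mulr1 // => i _; rewrite mnm0E.
Qed.

Theorem theorem3p13 (K : finFieldType) (q : nat) (hq : #|K| = q)
    (s : nat) (hs : (0 < s)%N) (G : {fset {mpoly K[s]}})
    (hG : forall g : {mpoly K[s]}, g \in G -> g != 0 /\ g \is homog mdeg)
    (hcolon :
      colon (vanishing_ideal [set: proj_space K s]) (ideal_gen [set` G])
      <> vanishing_ideal [set: proj_space K s]) :
  radical (ideal_gen (vanishing_ideal [set: proj_space K s] `|` [set` G]))
    = radical (ideal_gen (frobenius_binomials K s q `|` [set` G]))
  /\ radical (ideal_gen (frobenius_binomials K s q `|` [set` G]))
    = vanishing_ideal (proj_zeros [set` G]).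

Proof.
have homG g : [set` G] g -> g \is homog mdeg by move=> /hG[].
have [w Zw] := proj_zeros_neq0 homG hcolon.
set Z := proj_zeros _ in Zw *; set IP := vanishing_ideal setT.
set J := ideal_gen (_ _ _ q `|` _).
have idJ : is_ideal J := ideal_gen_ideal _.
have GJ : [set` G] `<=` J by move=> g Gg; apply: sub_ideal_gen; right.
have sJP : J `<=` ideal_gen (IP `|` [set` G]).
  apply: ideal_gen_sub; first exact: ideal_gen_ideal.
  move=> f [[i [j [_ ->]]]|Gf]; apply: sub_ideal_gen; [left|by right].
  by rewrite -hq; apply: frobenius_binomial_vanishing.
have sPZ : ideal_gen (IP `|` [set` G]) `<=` vanishing_ideal Z.
  apply: ideal_gen_sub => [|f [/vanishing_idealP fP|Gf]].
  - exact: ideal_gen_ideal.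
  - by apply/vanishing_idealP => v _; apply: fP.
  - apply: vanishing_ideal_homog; first exact: homG.
    by move=> v /(proj_zerosP v homG); apply.
(* The binomials are antisymmetric in [i] and [j], so the generators with [i < j] give all of
   them. *)
have frobJ (i j : 'I_s) : J ('X_i * 'X_j ^+ #|K| - 'X_i ^+ #|K| * 'X_j).
  have [lt_ij|lt_ji|/val_inj ->] := ltngtP i j.
  - by rewrite hq; apply: sub_ideal_gen; left; exists i, j.
  - rewrite -opprB mulrC ['X_i * _]mulrC; apply: (idealN idJ).
    by rewrite hq; apply: sub_ideal_gen; left; exists j, i.
  - by rewrite mulrC subrr; case: idJ.
have sZJ : vanishing_ideal Z `<=` radical J.
  apply: ideal_gen_sub; first exact: radical_ideal.
  move=> f [homf fZ].
  have [[|d] hf] := homogP _ _ homf.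
    rewrite (homog0_const (coords w) hf).
    have /(vanishes_at_homog w hf) -> := fZ _ Zw.
    by rewrite mpolyC0; apply: sub_radical; case: idJ.
  apply: (radical_of_mulX idJ hf) => // i.
  apply: (radical_mulX idJ frobJ i GJ homG homf) => v Zv.
  by apply/(vanishes_at_homog v hf)/fZ.
(* With [sZJ] and [sJP] this closes the cycle of inclusions, as [vanishing_ideal Z] is radical. *)
have sJZ : radical (ideal_gen (IP `|` [set` G])) `<=` vanishing_ideal Z.
  by move=> f /(radicalS sPZ)/vanishing_ideal_radical.
split; apply/seteqP; split.
- by move=> f /sJZ/sZJ.
- exact: radicalS.
- by move=> f /(radicalS sJP)/sJZ.
- exact: sZJ.
Qed.
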